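(* Let $\lambda>\kappa\ge\omega$ be cardinals and let $\mathcal{A}=\{A_\alpha:\alpha<\lambda\}\subseteq[\lambda]^{\ge\kappa}$ be a $\kappa$-hereditarily essentially disjoint family. Then there is a partition $\{X_\zeta:\zeta<\operatorname{cf}(\lambda)\}\subseteq[\lambda]^{<\lambda}$ of $\lambda$ (pairwise disjoint sets with union $\lambda$) such that, writing $X_{\le\zeta}=\bigcup_{\eta\le\zeta}X_\eta$ and $X_{<\zeta}=\bigcup_{\eta<\zeta}X_\eta$: (M1) $A_\alpha\cap A_{\alpha'}\subseteq X_{\le\zeta}$ for all $\zeta<\operatorname{cf}(\lambda)$ and all distinct $\alpha,\alpha'\in X_{\le\zeta}$; (M2) $|A_\alpha\cap X_{<\zeta}|<\kappa$ for all $\zeta<\operatorname{cf}(\lambda)$ and all $\alpha\in X_\zeta$; (M3) $|A_\alpha\cap X_\zeta|\ge\kappa$ for all $\zeta<\operatorname{cf}(\lambda)$ and all $\alpha\in X_\zeta$.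
   Context: $[X]^{\kappa}$, $[X]^{<\kappa}$, $[X]^{\ge\kappa}$ denote the sets of subsets of $X$ of size $\kappa$, $<\kappa$, $\ge\kappa$ respectively. A family $\mathcal{B}\subseteq[X]^{\kappa}$ is essentially disjoint iff for each $B\in\mathcal{B}$ there is $F(B)\in[B]^{<\kappa}$ such that the sets $B\setminus F(B)$, $B\in\mathcal{B}$, are pairwise disjoint. A family $\mathcal{A}$ is $\kappa$-hereditarily essentially disjoint iff for every function $H$ with domain $\mathcal{A}$ and $H(A)\in[A]^{\kappa}$ for all $A\in\mathcal{A}$, the family $\{H(A):A\in\mathcal{A}\}$ is essentially disjoint. *)

(* Defs.v *)
From HB Require Import structures.
From mathcomp Require Import all_boot all_order.
From mathcomp Require Import all_classical.
Set Implicit Arguments.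
Unset Strict Implicit.
Unset Printing Implicit Defensive.
Import Order.TTheory.
Local Open Scope order_scope.
Local Open Scope classical_set_scope.
Local Open Scope card_scope.

Definition card_lt (T U : Type) (A : set T) (B : set U) : Prop :=
  A #<= B /\ ~ (B #<= A).

Notation "A '#<' B" := (card_lt A B)
  (at level 79, format "A  '#<'  B") : card_scope.

(* The ordinals below the order type of a well-order [L] are encoded by the
   elements of [L]: an element z stands for the order type of {y | y < z}. *)
Definition below d (L : orderType d) (z : L) : set L := [set y | y < z].

(* [L] is a cardinal in von Neumann's sense, i.e. an initial ordinal. *)
Definition is_cardinal d (L : orderType d) : Prop :=
  well_founded (fun x y : L => x < y) /\
  forall z : L, below z #< [set: L].

(* cf(L) is the least ordinal c that has a map onto a cofinal subset of L.
   As c is at most the order type of L, it is encoded by an initial segment of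
   L: the set of all z such that no ordinal w <= z has such a map.  This is all
   of [L] exactly when cf(L) = L. *)
Definition has_cofinal_map d (L : orderType d) (w : L) : Prop :=
  exists f : L -> L, forall x : L, exists2 y, below w y & x <= f y.

Definition cf d (L : orderType d) : set L :=
  [set z | forall w : L, w <= z -> ~ has_cofinal_map w].
Arguments cf {d} L.

(* [X]^k, [X]^{<k} and [X]^{>=k}, where k is the cardinality of the type [K]. *)
Definition subsets_eq (K T : Type) (X : set T) : set (set T) :=
  [set A | A `<=` X /\ A #= [set: K]].
Definition subsets_lt (K T : Type) (X : set T) : set (set T) :=
  [set A | A `<=` X /\ A #< [set: K]].
Definition subsets_ge (K T : Type) (X : set T) : set (set T) :=
  [set A | A `<=` X /\ [set: K] #<= A].

(* Families are sets of sets, so that repetitions are not counted. *)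
Definition essentially_disjoint (K T : Type) (B : set (set T)) : Prop :=
  exists F : set T -> set T,
    (forall b, B b -> subsets_lt K b (F b)) /\
    trivIset B (fun b => b `\` F b).

Definition hereditarily_essentially_disjoint (K T : Type)
    (A : set (set T)) : Prop :=
  forall H : set T -> set T,
    (forall a, A a -> subsets_eq K a (H a)) ->
    essentially_disjoint K (H @` A).

Definition union_lt d (L : orderType d) (X : L -> set L) (z : L) : set L :=
  \bigcup_(y in [set y | y < z]) X y.
Definition union_le d (L : orderType d) (X : L -> set L) (z : L) : set L :=
  \bigcup_(y in [set y | y <= z]) X y.

(* Main.v *)
(* By heredity, if each [A x] is given a subset [H x] of size |K|, some function
   [f] maps a point of [H x] to [x], for every [x].  For an increasing chain of
   sets, one can choose [H] such that [H x] lies in every member of the chain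
   that meets [A x] in at least |K| points, so all such [x] belong to the member
   as soon as it is closed under [f].  One therefore covers L by an increasing
   chain [N z], z < cf(L), of sets of size < |L| that are closed under the
   intersections [A x `&` A y] and whose unions [union_lt N z] contain every [x]
   with |A x `&` union_lt N z| >= |K|, and sets X_z := N_z \ union_(y < z) N_y.
   For regular L the chain consists of initial segments.  For singular L, |K|^+
   is smaller than |L| and the construction of [f] is iterated |K|^+ times. *)
Require Import Defs.
From HB Require Import structures.
From mathcomp Require Import all_boot all_order.
From mathcomp Require Import all_classical.
From Stdlib Require Import Relation_Operators Lexicographic_Product.
From Stdlib Require Import Inverse_Image.
Set Implicit Arguments.
Unset Strict Implicit.
Unset Printing Implicit Defensive.
Import Order.TTheory.
Local Open Scope order_scope.
Local Open Scope classical_set_scope.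
Local Open Scope card_scope.

(** * Cardinal arithmetic *)

Lemma card_le_funP T U (A : set T) (B : set U) (u : U) :
  A #<= B <-> exists2 f : T -> U, set_fun A B f & set_inj A f.
Proof.
split=> [/card_leP[f]|/injfunPex[f]]; last exact: inj_card_le.
by apply/injfunPex; squash (valLR u f).
Qed.

Lemma card_le_surj T U (A : set T) (B : set U) (f : U -> T) :
  A `<=` f @` B -> A #<= B.
Proof. by move=> /subset_card_le/card_le_trans; apply; exact: card_image_le. Qed.

Lemma card_leX T U (A : set T) (B : set U) :
  A #<= B -> A `*` A #<= B `*` B.
Proof.
have [->|/set0P[u Bu]] := eqVneq B set0; first by rewrite card_le0 => /eqP ->; rewrite setX0.
move=> /(card_le_funP _ _ u)[f fAB fI].
apply/(card_le_funP _ _ (u, u)); exists (fun p => (f p.1, f p.2)).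
  by move=> [x y] [/= ? ?]; split; apply: fAB.
move=> [x y] [x' y']; rewrite !inE => -[/= ? ?] [/= ? ?] [fx fy].
by congr pair; apply: fI; rewrite ?inE.
Qed.

(** A step that sees only the set of earlier values suffices both for greedy injections and for
    iterating selectors. *)
Lemma wf_image_rec T U (R : T -> T -> Prop) (G : T -> set U -> U) :
  well_founded R ->
  exists F : T -> U, forall x, F x = G x (F @` [set y | R y x]).
Proof.
move=> wfR.
pose Phi x (rec : forall y, R y x -> U) :=
  G x [set u | exists y (h : R y x), rec y h = u].
have PhiE x (f g : forall y, R y x -> U) :
    (forall y h, f y h = g y h) -> Phi x f = Phi x g.
  move=> fg; congr (G x _); apply/seteqP.
  by split=> u [y [h <-]]; exists y, h; rewrite fg.
exists (Fix wfR (fun _ => U) Phi) => x; rewrite Fix_eq//; congr (G x _).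
by apply/seteqP; split=> u [y]; [move=> [h <-]; exists y | move=> h <-; exists y, h].
Qed.

Lemma wf_min T (R : T -> T -> Prop) (P : set T) :
  well_founded R -> P !=set0 -> exists2 x, P x & forall y, P y -> ~ R y x.
Proof.
move=> wfR [x Px]; apply: contrapT => nomin.
elim/(well_founded_ind wfR): x Px => x IH Px.
by apply: nomin; exists x => // y Py /IH; apply.
Qed.

(** Send each point of [B] greedily to a fresh point of [Y]. This gets stuck at some [b] only if the
    images of the earlier points of [B] exhaust [Y]. *)
Lemma wf_card_dichotomy T U (R : T -> T -> Prop) (B : set T) (Y : set U) :
  well_founded R -> (forall x y, [\/ R x y, x = y | R y x]) ->
  B #<= Y \/ exists2 b, B b & Y #<= B `&` [set x | R x b].
Proof.
move=> wfR totR.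
have [|noseg] := pselect (exists2 b, B b & Y #<= B `&` [set x | R x b]).
  by right.
left.
have [->|/set0P[b0 Bb0]] := eqVneq B set0; first exact: card_ge0.
have [Y0|/set0P[u _]] := eqVneq Y set0.
  by exfalso; apply: noseg; exists b0 => //; rewrite Y0 card_ge0.
have wfR' : well_founded (fun x y => B x /\ R x y).
  by move=> x; elim/(well_founded_ind wfR): x => x IH; split=> y [_ /IH].
have /choice[c cP] : forall S : set U, exists y, S !=set0 -> S y.
  by move=> S; have [[y Sy]|] := pselect (S !=set0); [exists y|exists u].
have [F FE] := wf_image_rec (fun _ S => c (Y `\` S)) wfR'.
have FY b : B b -> (Y `\` F @` [set y | B y /\ R y b]) (F b).
  move=> Bb; rewrite FE; apply: cP; apply: contrapT => none.
  apply: noseg; exists b => //; apply: (@card_le_surj _ _ _ _ F) => y Yy.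
  by apply: contrapT => Fy; apply: none; exists y.
apply/(card_le_funP _ _ u); exists F => [b /FY[]//|x y].
rewrite !inE => Bx By FxFy.
have [Rxy|//|Ryx] := totR x y.
- by have [_] := FY y By; case; exists x.
- by have [_] := FY x Bx; case; exists y.
Qed.

(** Hilbert's hotel: [g] embeds the natural numbers in [A], and a surjection sends [g 0] to [x],
    [g n.+1] to [g n] and fixes all else. *)
Lemma card_le_setU1 T (A : set T) (x : T) :
  infinite_set A -> x |` A #<= A.
Proof.
move=> /infiniteP; have [Ax _|nAx] := pselect (A x).
  by apply: subset_card_le => y [->|].
move=> /(card_le_funP _ _ x)[g gA gI].
have gI' m n : g m = g n -> m = n by apply: gI; rewrite inE.
apply: (@card_le_surj _ _ _ _ (fun y =>
  if pselect (exists n, y = g n) is left e then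
    (if sval (cid e) is n.+1 then g n else x) else y)).
move=> y [->|Ay].
  exists (g 0%N); first exact: gA.
  case: pselect => [e|[]]; last by exists 0%N.
  by case: cid => /= n /gI' <-.
have [[n ->]|ny] := pselect (exists n, y = g n).
  exists (g n.+1); first exact: gA.
  case: pselect => [e|[]]; last by exists n.+1.
  by case: cid => /= m /gI' <-.
by exists y => //; case: pselect.
Qed.

(** Encode a point by the code of one chosen index and its own code within that member of the
    family. *)
Lemma card_bigcup_le T U I (X : set U) (D : set I) (F : I -> set T) :
  X `*` X #<= X -> D #<= X -> (forall i, D i -> F i #<= X) ->
  \bigcup_(i in D) F i #<= X.
Proof.
move=> XX DX FX.
have [->|/set0P[i0 Di0]] := eqVneq D set0; first by rewrite bigcup_set0 card_ge0.
have [X0|/set0P[u Xu]] := eqVneq X set0.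
  by move: DX Di0; rewrite X0 card_le0 => /eqP ->.
have [->|/set0P[t _]] := eqVneq (\bigcup_(i in D) F i) set0; first exact: card_ge0.
apply: card_le_trans XX.
have {DX}[p pX pI] := (card_le_funP D X u).1 DX.
have /choice[q qP] : forall i, exists q : T -> U, D i ->
    set_fun (F i) X q /\ set_inj (F i) q.
  move=> i; have [Di|] := pselect (D i); last by exists (fun=> u).
  by have [q ? ?] := (card_le_funP (F i) X u).1 (FX i Di); exists q.
have /choice[i iP] : forall y, exists i, (\bigcup_(i in D) F i) y -> D i /\ F i y.
  move=> y; have [[i Di Fi]|] := pselect ((\bigcup_(i in D) F i) y); last by exists i0.
  by exists i.
apply/(card_le_funP _ _ (u, u)); exists (fun y => (p (i y), q (i y) y)).
  by move=> y /iP[Di Fi]; split=> /=; [exact: pX | exact: (qP _ Di).1].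
move=> y y'; rewrite !inE => /iP[Di Fi] /iP[Di' Fi'] [pii'].
have ii' : i y = i y' by apply: pI; rewrite ?inE.
by rewrite -ii' in Fi' *; apply: (qP _ Di).2; rewrite inE.
Qed.

Lemma card_setU_le T U (X : set U) (A B : set T) :
  infinite_set X -> X `*` X #<= X -> A #<= X -> B #<= X -> A `|` B #<= X.
Proof.
move=> /infiniteP Xinf XX AX BX.
have -> : A `|` B = \bigcup_(b in [set: bool]) (if b then A else B).
  apply/seteqP; split=> x [].
  - by move=> Ax; exists true.
  - by move=> Bx; exists false.
  - by case=> _ /=; [left|right].
apply: card_bigcup_le => //; last by case.
by apply: card_le_trans Xinf; exact: countableP.
Qed.

Lemma card_lt_infinite T U (A : set T) (B : set U) :
  infinite_set B -> finite_set A -> A #< B.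
Proof.
move=> Binf Afin; split; last by move=> /card_le_finite /(_ Afin).
have Acnt : A #<= [set: nat] by exact: finite_set_countable.
by apply: card_le_trans Acnt _; exact/infiniteP.
Qed.

Lemma card_le_lt_trans T U V (A : set T) (B : set U) (C : set V) :
  A #<= B -> B #< C -> A #< C.
Proof.
move=> AB [BC nCB]; split; first exact: card_le_trans BC.
by move=> CA; apply/nCB/(card_le_trans CA).
Qed.

Lemma card_lt_le_trans T U V (A : set T) (B : set U) (C : set V) :
  A #< B -> B #<= C -> A #< C.
Proof.
move=> [AB nBA] BC; split; first exact: card_le_trans BC.
by move=> /(card_le_trans BC).
Qed.

(** * Cardinal arithmetic in a well-order *)

Section WellOrder.
Context {d : Order.disp_t} {L : orderType d}.
Hypothesis wfL : well_founded (fun x y : L => x < y).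
Implicit Types x y z v w : L.

Lemma least_elt (P : set L) :
  P !=set0 -> exists2 x, P x & forall y, P y -> x <= y.
Proof.
by move=> /(wf_min wfL)[x Px xmin]; exists x => // y /xmin/negP; rewrite -leNgt.
Qed.

Lemma lt_trichotomy x y : [\/ x < y, x = y | y < x].
Proof. by have [xy|yx|->] := ltgtP x y; [apply: Or31|apply: Or33|apply: Or32]. Qed.

Lemma card_le_below U (B : set L) (Y : set U) :
  B #<= Y \/ exists2 b, B b & Y #<= B `&` below b.
Proof. exact: wf_card_dichotomy wfL lt_trichotomy. Qed.

Lemma card_ltNge U (B : set L) (Y : set U) : ~ (Y #<= B) -> B #< Y.
Proof.
move=> nYB; split => //; have [//|[b _ Yb]] := card_le_below B Y.
by case: nYB; apply: card_le_trans Yb _; apply: subset_card_le => x [].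
Qed.

(* [below z `*` below z] is well-ordered by the maximum first (Goedel's order);
   its proper initial segments lie in squares of smaller initial segments. *)
Lemma card_square_below z : infinite_set (below z) ->
  below z `*` below z #<= below z.
Proof.
elim/(well_founded_ind wfL): z => z IH zinf.
(* If [below z] embeds in a smaller segment, induction applies to that segment; otherwise [z] is an
   initial ordinal. *)
have [[v vz zv]|zinit] := pselect (exists2 v, v < z & below z #<= below v).
  apply: card_le_trans (card_leX zv) _.
  apply: card_le_trans (IH v vz _) _; first by move=> /(card_le_finite zv).
  by apply: subset_card_le => x /lt_trans; apply.
pose lt2 (p q : L * L) := slexprod L L (fun x y => x < y) (fun x y => x < y) p q.
pose lt3 := slexprod L (L * L) (fun x y => x < y) lt2.
pose R (p q : L * L) := lt3 (Order.max p.1 p.2, p) (Order.max q.1 q.2, q).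
have lt3_fst p q : lt3 p q -> p.1 <= q.1 by case=> [a a' b b' /ltW|].
have wfR : well_founded R.
  by apply: (wf_inverse_image _ _ lt3); do !apply: wf_slexprod.
have totR p q : [\/ R p q, p = q | R q p].
  case: p q => [x y] [x' y'].
  have [mm'|mm'|mm'] := ltgtP (Order.max x y) (Order.max x' y').
  - by apply: Or31; apply: left_slex.
  - by apply: Or33; apply: left_slex.
  rewrite /R /= mm'.
  have [xx'|xx'|->] := ltgtP x x'.
  - by apply: Or31; apply: right_slex; apply: left_slex.
  - by apply: Or33; apply: right_slex; apply: left_slex.
  have [yy'|yy'|->] := ltgtP y y'.
  - by apply: Or31; do !apply: right_slex.
  - by apply: Or33; do !apply: right_slex.
  exact: Or32.
have [//|[[x y] [/= xz yz] zle]] := wf_card_dichotomy (below z `*` below z)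
  (below z) wfR totR.
exfalso; pose m := Order.max x y.
have mz : m < z by rewrite /below /m/= gt_max xz yz.
pose M := m |` below m.
have {}zle : below z #<= M `*` M.
  apply: card_le_trans zle _; apply: subset_card_le => -[x' y'] [_ /=].
  rewrite /R/= => lt.
  have : Order.max x' y' <= m.
    exact: (lt3_fst _ _ lt).
  rewrite ge_max => /andP[x'm y'm].
  by split; rewrite /M /below /=; [move: x'm|move: y'm];
    rewrite le_eqVlt => /predU1P; tauto.
(* A finite [M] contradicts [zinf]; for an infinite one, induction at [m] embeds the square of [M]
   in [below m], against [zinit]. *)
have [mfin|minf] := pselect (finite_set (below m)).
  apply: zinf; apply: card_le_finite zle _.
  by apply: finite_setX; rewrite /M finite_setU; split => //; exact: finite_set1.
apply: zinit; exists m => //; apply: card_le_trans zle _.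
by apply: card_le_trans (IH m mz minf); apply/card_leX/card_le_setU1.
Qed.

Lemma card_eq_below U (Y : set U) : Y #< [set: L] -> exists z, Y #= below z.
Proof.
move=> [YL nLY].
have [|z Yz zmin] := @least_elt [set z | Y #<= below z].
  have [//|[z _]] := card_le_below [set: L] Y.
  by rewrite setTI => Yz; exists z.
exists z; apply: Cantor_Bernstein => //.
have [//|[v vz Yv]] := card_le_below (below z) Y.
have /zmin : Y #<= below v by apply: card_le_trans Yv _; apply: subset_card_le => x [].
by rewrite leNgt => /negP.
Qed.

Lemma card_square U (Y : set U) :
  infinite_set Y -> Y #< [set: L] -> Y `*` Y #<= Y.
Proof.
move=> Yinf /card_eq_below[z]; rewrite card_eq_le => /andP[Yz zY].
apply: card_le_trans (card_leX Yz) _; apply: card_le_trans zY.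
by apply: card_square_below => /(card_le_finite Yz).
Qed.

Lemma card_lt_setU T U (X : set U) (A B : set T) :
  infinite_set X -> X #< [set: L] -> A #< X -> B #< X -> A `|` B #< X.
Proof.
move=> Xinf XL.
(* [A] and [B] live in an arbitrary type; they are compared through equipotent initial segments of
   [L]. *)
wlog AB : A B / A #<= B => [wlg AX BX|].
  have [a] := card_eq_below (card_lt_le_trans AX XL.1).
  have [b] := card_eq_below (card_lt_le_trans BX XL.1).
  rewrite !card_eq_le => /andP[Bb bB] /andP[Aa aA].
  have [ab|ba] := leP a b.
    apply: wlg => //; apply: card_le_trans Aa (card_le_trans _ bB).
    by apply: subset_card_le => x /lt_le_trans; apply.
  rewrite setUC; apply: wlg => //; apply: card_le_trans Bb (card_le_trans _ aA).
  by apply: subset_card_le => x /lt_trans; apply.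
move=> AX BX.
have [Bfin|Binf] := pselect (finite_set B).
  apply: card_lt_infinite => //; rewrite finite_setU; split=> //.
  exact: card_le_finite Bfin.
apply: card_le_lt_trans (BX); apply: card_setU_le; rewrite ?card_lexx //.
by apply: card_square => //; exact: card_lt_le_trans BX XL.1.
Qed.
End WellOrder.

(** * Closure under set-valued operations *)

(** Set values let one operation combine intersections, chosen subsets and selectors; a unary
    operation ignores one argument. *)
Definition op_closed T (Op : T -> T -> set T) (C : set T) : Prop :=
  forall x y, C x -> C y -> Op x y `<=` C.

Lemma op_closed_smallest T (Op : T -> T -> set T) (S : set T) :
  op_closed Op (smallest (op_closed Op) S).
Proof.
move=> x y Sx Sy t Opt C [CC SC].
by apply: (CC x y) Opt; [exact: Sx C (conj CC SC)|exact: Sy C (conj CC SC)].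
Qed.

Lemma smallest_op_closed_mono T (Op Op' : T -> T -> set T) (S S' : set T) :
  (forall x y, Op x y `<=` Op' x y) -> S `<=` S' ->
  smallest (op_closed Op) S `<=` smallest (op_closed Op') S'.
Proof.
move=> OpOp' SS'; apply: smallest_sub.
  move=> x y Sx Sy; apply: subset_trans (OpOp' x y) _.
  exact: op_closed_smallest.
by apply: subset_trans SS' _; exact: sub_gen_smallest.
Qed.

Lemma op_closed_bigcup_nat T (Op : T -> T -> set T) (S : nat -> set T) :
  (forall n, S n `<=` S n.+1) ->
  (forall n x y, S n x -> S n y -> Op x y `<=` S n.+1) ->
  op_closed Op (\bigcup_n S n).
Proof.
move=> Ssub SOp x y [m _ Sx] [n _ Sy].
have Smono : forall k l, (k <= l)%N -> S k `<=` S l.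
  move=> k l /subnKC <-; elim: (l - k)%N => [|j IH]; first by rewrite addn0.
  by rewrite addnS; exact: subset_trans IH _.
move=> t Opt; exists (maxn m n).+1 => //.
by apply: SOp Opt; [exact: Smono (leq_maxl _ _) _ Sx|exact: Smono (leq_maxr _ _) _ Sy].
Qed.

(** The closure lies in a union of countably many stages, each adding to the previous one at most
    |X| sets of size at most |X|. *)
Lemma card_smallest_op_closed T U (X : set U) (Op : T -> T -> set T) (S : set T) :
  infinite_set X -> X `*` X #<= X -> S #<= X -> (forall x y, Op x y #<= X) ->
  smallest (op_closed Op) S #<= X.
Proof.
move=> Xinf XX SX OpX.
pose step C := C `|` \bigcup_(p in C `*` C) Op p.1 p.2.
pose Sn n := iter n step S.
apply: (@card_le_trans _ _ _ (\bigcup_n Sn n)).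
  apply: subset_card_le; apply: smallest_sub; last by move=> x Sx; exists 0%N.
  apply: op_closed_bigcup_nat => [n x|n x y Sx Sy t Opt]; first by left.
  by right; exists (x, y).
apply: card_bigcup_le => //; first exact: (infiniteP _).1 Xinf.
move=> n _; elim: n => [//|n IH]; apply: card_setU_le => //.
apply: card_bigcup_le => //.
by apply: card_le_trans (card_leX IH) XX.
Qed.

(** * Closed chains *)

Section HereditarilyEssentiallyDisjoint.
Context {K : Type} {d : Order.disp_t} {L : orderType d} {A : L -> set L}.
Hypothesis L_card : is_cardinal L.
Hypothesis K_infinite : [set: nat] #<= [set: K].
Hypothesis K_lt_L : [set: K] #< [set: L].
Hypothesis A_inj : injective A.
Hypothesis A_ge : forall a : L, subsets_ge K [set: L] (A a).
Hypothesis A_hed : hereditarily_essentially_disjoint K (range A).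
Implicit Types x y z v w : L.

Let wfL : well_founded (fun x y : L => x < y) := L_card.1.
Let Kinf : infinite_set [set: K] := (infiniteP _).2 K_infinite.
Let Linf : infinite_set [set: L] :=
  (infiniteP _).2 (card_le_trans K_infinite K_lt_L.1).

(** * Almost disjointness and selectors *)

Lemma subset_of_card (B : set L) : [set: K] #<= B ->
  exists2 C, C `<=` B & C #= [set: K].
Proof.
have [->|/set0P[u _]] := eqVneq B set0.
  by rewrite card_le0 => /eqP KO; exists set0 => //; rewrite KO card_eq00.
move=> /(card_le_funP _ _ u)[f fB fI]; exists (range f).
  by move=> _ [k _ <-]; exact: fB.
exact: inj_card_eq.
Qed.

Lemma subsets_eq_inhab x : exists B, subsets_eq K (A x) B.
Proof. by have [B BA BK] := subset_of_card (A_ge x).2; exists B. Qed.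

(** Otherwise [H] could pick [B] in [A x] and [B] minus a point in [A y]. Deleting the point keeps
    the two choices distinct, since a set of sets merges equal ones. Their exceptional sets would
    then have to cover [B'], which has size |K|. *)
Lemma almost_disjoint x y : x <> y -> ~ ([set: K] #<= A x `&` A y).
Proof.
move=> xy /subset_of_card[B BA BK].
have Binf : infinite_set B by rewrite (eq_finite_set BK).
have [b Bb] := infinite_setN0 Binf.
pose B' := B `\ b.
have B'inf : infinite_set B' by apply: infinite_setD => //; exact: finite_set1.
have B'K : B' #= [set: K].
  apply: card_eq_trans BK; apply: Cantor_Bernstein; first exact: card_le_setD.
  apply: card_le_trans (card_le_setU1 b B'inf).
  by apply: subset_card_le => t Bt; have [->|tb] := pselect (t = b); [left|right].
have [H0 H0K] := choice subsets_eq_inhab.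
have /choice[g gA] : forall s, exists z, range A s -> A z = s.
  move=> s; have [[z _ <-]|] := pselect (range A s); first by exists z.
  by exists x.
pose H s := if pselect (s = A x) then B else if pselect (s = A y) then B'
            else H0 (g s).
have [s [z _ <-]|F [FK Ftriv]] := A_hed (H := H).
  rewrite /H; case: pselect => [e|_] /=; first by rewrite e; split=> // t /BA[].
  case: pselect => [e|_] /=; first by rewrite e; split=> // t [/BA[]].
  by rewrite -{1}(gA (A z)); [exact: H0K|exists z].
have HB : (H @` range A) B.
  by exists (A x); [exists x|rewrite /H; case: pselect].
have HB' : (H @` range A) B'.
  exists (A y); first by exists y.
  rewrite /H; case: pselect => [yx|_] /=; first by case: xy; apply/esym/A_inj.
  by case: pselect.
have KF : F B `|` F B' #< [set: K].
  by apply: (card_lt_setU wfL) => //; [exact: (FK _ HB).2|exact: (FK _ HB').2].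
apply: KF.2; apply: card_le_trans ((card_eqPle _ _).1 B'K).2 _.
apply: subset_card_le => t B't; apply: contrapT => /not_orP[nFB nFB'].
have [_ /(_ erefl)//] : B' b by rewrite -(Ftriv _ _ HB HB') //; exists t; split; split => //; case: B't.
Qed.

(* [f] sends the points of [H x `\` F (H x)], which lie in no other
   [H x' `\` F (H x')], to [x]. *)
Lemma exists_selector (H : L -> set L) :
  (forall x, subsets_eq K (A x) (H x)) ->
  exists f : L -> L, forall x, exists2 y, H x y & f y = x.
Proof.
move=> HK.
(* Distinct indices get distinct sets, so disjointness over the set of all [H x] is disjointness
   over indices. *)
have H_inj x x' : H x = H x' -> x = x'.
  move=> HH; apply: contrapT => /almost_disjoint; apply.
  apply: card_le_trans ((card_eqPle _ _).1 (HK x).2).2 _.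
  apply: subset_card_le => t Ht; split; first exact: (HK x).1.
  by apply: (HK x').1; rewrite -HH.
have /choice[g gA] : forall s, exists z, range A s -> A z = s.
  move=> s; have [[z _ <-]|ns] := pselect (range A s); first by exists z.
  have [z _] := infinite_setN0 Linf.
  by exists z.
have gAK z : g (A z) = z by apply: A_inj; rewrite gA//; exists z.
have [_ [z _ <-]|F [FK Ftriv]] := A_hed (H := H \o g).
  by rewrite /= gAK.
have HA z : ((H \o g) @` range A) (H z).
  by exists (A z); [exists z|rewrite /= gAK].
have /choice[f fP] : forall y, exists x, forall x', (H x' `\` F (H x')) y -> x = x'.
  move=> y; have [[x Hx]|nx] := pselect (exists x, (H x `\` F (H x)) y).
    exists x => x' Hx'; apply/H_inj/Ftriv; [exact: HA|exact: HA|by exists y].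
  by exists y => x' Hx'; case: nx; exists x'.
exists f => x; have [y yP] : H x `\` F (H x) !=set0.
  apply: contrapT => HF; apply: (FK _ (HA x)).2.2.
  apply: card_le_trans ((card_eqPle _ _).1 (HK x).2).2 _.
  by apply: subset_card_le => t Ht; apply: contrapT => nFt; apply: HF; exists t.
by exists y; [case: yP|exact: fP].
Qed.

(* A single choice of [H x] serves all [z] at once: take a subset of [A x] in
   the first [P z] that meets [A x] in at least |K| points. *)
Lemma exists_chain_selector (P : L -> set L) :
  (forall z z', z <= z' -> P z `<=` P z') ->
  exists f : L -> L, forall x z, [set: K] #<= A x `&` P z ->
    exists2 y, P z y & f y = x.
Proof.
move=> Pmono.
have /choice[H HP] : forall x, exists B, subsets_eq K (A x) B /\
    forall z, [set: K] #<= A x `&` P z -> B `<=` P z.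
  move=> x; have [Px|nP] := pselect ([set z | [set: K] #<= A x `&` P z] !=set0).
    have [z /subset_of_card[B BAP BK] zmin] := least_elt wfL Px.
    exists B; split; first by split=> // t /BAP[].
    by move=> z' /zmin/Pmono zz' t /BAP[_ /zz'].
  have [B BK] := subsets_eq_inhab x; exists B; split=> // z Pz.
  by case: nP; exists z.
have [f fP] := exists_selector (fun x => (HP x).1).
by exists f => x z /(HP x).2 HPz; have [y Hy <-] := fP x; exists y => //; exact: HPz.
Qed.

(** * Chains of small closed sets *)

Section Chains.
Variable Op : L -> L -> set L.
Hypothesis Op_le : forall x y, Op x y #<= [set: K].

(** The last clause concerns [union_lt N z]: contraposed, it bounds [A x] on the earlier pieces for
    each [x] first met at stage [z], which is (M2). *)
Definition good_chain (N : L -> set L) : Prop :=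
  [/\ (forall z, cf L z -> N z #< [set: L]),
      (forall z z', z <= z' -> N z `<=` N z'),
      (forall x, exists2 z, cf L z & N z x),
      (forall z, cf L z -> op_closed Op (N z)) &
      (forall z x, cf L z -> [set: K] #<= A x `&` union_lt N z -> union_lt N z x)].

Lemma op_closed_union_lt (N : L -> set L) (Op' : L -> L -> set L) z :
  (forall y y', y <= y' -> N y `<=` N y') ->
  (forall y, y < z -> op_closed Op' (N y)) -> op_closed Op' (union_lt N z).
Proof.
move=> Nmono NOp x x' [y /= yz Nyx] [y' /= y'z Nyx'] t Opt.
exists (Order.max y y'); first by rewrite /= gt_max yz.
have mz : Order.max y y' < z by rewrite gt_max yz.
apply: (NOp _ mz x x') Opt.
  by apply: Nmono Nyx; rewrite le_max lexx.
by apply: Nmono Nyx'; rewrite le_max lexx orbT.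
Qed.

Section Regular.
Hypothesis regL : forall w : L, ~ has_cofinal_map w.

(** [w] encodes |I|, so an unbounded [h], moved to [below w] along [p], would be a cofinal map. *)
Lemma regular_bounded T (I : set T) (h : T -> L) :
  I #< [set: L] -> exists b, forall i, I i -> h i < b.
Proof.
move=> /(card_eq_below wfL)[w]; rewrite card_eq_le => /andP[Iw _].
have [p pw pI] := (card_le_funP I (below w) w).1 Iw.
have /choice[f fP] : forall y, exists l, forall i, I i -> p i = y -> h i = l.
  move=> y; have [[i [Ii piy]]|ni] := pselect (exists i, I i /\ p i = y).
    exists (h i) => j Ij pjy; congr (h _).
    by apply: pI; rewrite ?inE // pjy.
  by exists y => i Ii piy; case: ni; exists i.
apply: contrapT => nb; apply: (regL (w := w)); exists f => x.
apply: contrapT => nx; apply: nb; exists x => i Ii.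
rewrite ltNge; apply/negP => xhi; apply: nx; exists (p i); first exact: pw.
by rewrite -(fP (p i) i).
Qed.

(* Closing under [below] makes every union of the chain an initial segment, so
   the selector of the chain of initial segments suffices. *)
Lemma regular_good_chain : exists N, good_chain N.
Proof.
have [f fP] := @exists_chain_selector (@below d L)
  (fun z z' zz' t tz => lt_le_trans tz zz').
pose Op' x y := Op x y `|` below x `|` [set f x].
pose N z := smallest (op_closed Op') [set z].
have NOp' z : op_closed Op' (N z) by exact: op_closed_smallest.
have Nz z : N z z by exact: sub_gen_smallest.
have belowN z x y : y < x -> N z x -> N z y.
  by move=> yx Nx; apply: (NOp' z x x) => //; left; right.
have Nmono z z' : z <= z' -> N z `<=` N z'.
  rewrite le_eqVlt => /predU1P[->//|zz']; apply: smallest_sub; first exact: NOp'.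
  by move=> _ ->; exact: belowN zz' (Nz z').
have [m mP] : exists m : L -> L -> L, forall x y, Op' x y `<=` below (m x y).
  have /choice[m mP] : forall p : L * L, exists b, Op' p.1 p.2 `<=` below b.
    move=> [x y] /=.
    have [b bP] := regular_bounded id (card_le_lt_trans (Op_le x y) K_lt_L).
    have [c cP] := regular_bounded id (L_card.2 x).
    have [e eP] := @regular_bounded _ [set f x] id
      (card_lt_infinite Linf (finite_set1 _)).
    exists (Order.max b (Order.max c e)) => t; rewrite /below /= !lt_max.
    by move=> [[/bP->//|/cP->]|/eP->]; rewrite !orbT.
  by exists (fun x y => m (x, y)) => x y; exact: mP (x, y).
(* [g b] bounds [m] on the square of [below b]; regularity is applied in one coordinate, then in the
   other. *)
have /choice[g gP] : forall b, exists c, forall x y, x < b -> y < b -> m x y < c.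
  move=> b.
  have /choice[h hP] : forall x, exists c, forall y, y < b -> m x y < c.
    by move=> x; exact: regular_bounded (m x) (L_card.2 b).
  have [c cP] := regular_bounded h (L_card.2 b).
  by exists c => x y xb yb; apply: lt_trans (cP x xb); exact: hP.
have N_lt z : N z #< [set: L].
  have [b0 b0P] := @regular_bounded _ [set z] id
    (card_lt_infinite Linf (finite_set1 _)).
  (* Iterating [g] from above [z] yields a set closed under [Op']; it stays below some [c] because
     |L| is uncountable and regular. *)
  pose b n := iter n (fun c => Order.max c (g c)) b0.
  have [c cP] := @regular_bounded _ setT b (card_le_lt_trans K_infinite K_lt_L).
  apply: card_le_lt_trans (L_card.2 c); apply: subset_card_le.
  apply: (@subset_trans _ (\bigcup_n below (b n))); last first.
    by move=> t [n _ /lt_trans]; apply; exact: cP.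
  apply: smallest_sub; last by move=> _ ->; exists 0%N => //; exact: b0P.
  apply: op_closed_bigcup_nat => [n t|n x y xb yb t /mP tm].
    by rewrite /below /= lt_max => ->.
  by rewrite /below /= lt_max (lt_trans tm (gP _ _ _ xb yb)) orbT.
have cfT z : cf L z by move=> w _; exact: regL.
exists N; split=> // [x|z _|z x _ KA]; first by exists x.
- by move=> x y Nx Ny t Opt; apply: (NOp' z x y) => //; left; left.
have DOp : op_closed Op' (union_lt N z) by apply: op_closed_union_lt.
(* [union_lt N z] lies in the small set [N z], so it misses a point; being downward closed, it is
   [below v] for the least such point. *)
have [v nDv vmin] : exists2 v, ~ union_lt N z v & forall y, ~ union_lt N z y -> v <= y.
  apply: (@least_elt _ _ wfL [set v | ~ union_lt N z v]).
  apply: contrapT => D; apply: (N_lt z).2; apply: subset_card_le => x' _.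
  have [y /= /ltW yz] : union_lt N z x' by apply: contrapT => ?; apply: D; exists x'.
  exact: Nmono yz _.
have DE : union_lt N z = below v.
  apply/seteqP; split=> y.
    move=> Dy; rewrite /below /= ltNge le_eqVlt; apply/negP => /predU1P[vy|vy].
      by apply: nDv; rewrite vy.
    by apply: nDv; apply: (DOp y y) => //; left; right.
  move=> yv; apply: contrapT => /vmin; rewrite leNgt => /negP; exact.
rewrite DE in KA; have [y yv <-] := fP x v KA.
by apply: (DOp y y); rewrite ?DE //; right.
Qed.
End Regular.

(* Here |K|^+ < |L|; it is encoded by the least [w] with more than |K|
   predecessors.  The selector [F i], [i < w], is the one of the chain obtained
   by closing under the [F j], [j < i].  A set of |K| points of the union of
   these [w] chains already lies in one of them. *)
Lemma singular_good_chain : (exists w : L, has_cofinal_map w) ->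
  exists N, good_chain N.
Proof.
move=> /(least_elt wfL)[th [g gP] thmin].
have cfE z : cf L z <-> z < th.
  split=> [cfz|zth u uz /thmin]; last by rewrite leNgt (le_lt_trans uz zth).
  by rewrite ltNge; apply/negP => /cfz; apply; exists g.
have KK : [set: K] `*` [set: K] #<= [set: K] by exact: (card_square wfL).
have finK T (I : set T) : finite_set I -> I #<= [set: K].
  by move=> /(card_lt_infinite Kinf)[].
(* If there were no such [w], then [L] would be a union of at most |K| segments of size at most |K|,
   as [g] is cofinal on [below th]. *)
have [w wK wmin] : exists2 w, ~ (below w #<= [set: K]) &
    forall v, ~ (below v #<= [set: K]) -> w <= v.
  apply: (@least_elt _ _ wfL [set v | ~ (below v #<= [set: K])]).
  apply: contrapT => noneK; apply: K_lt_L.2.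
  have belowK v : below v #<= [set: K].
    by apply: contrapT => nv; apply: noneK; exists v.
  apply: (@card_le_trans _ _ _
    (\bigcup_(y in below th) ([set g y] `|` below (g y)))).
    apply: subset_card_le => x _; have [y yth] := gP x.
    by rewrite le_eqVlt => /predU1P[->|xy]; exists y => //; [left|right].
  apply: card_bigcup_le => // y _; apply: card_setU_le => //.
  exact/finK/finite_set1.
have ltwK v : v < w -> below v #<= [set: K].
  by move=> vw; apply: contrapT => /wmin; rewrite leNgt vw.
(* Regularity of |K|^+: an unbounded family would cover [below w] by at most |K| sets of size at
   most |K|. *)
have wbound T (I : set T) (h : T -> L) : I #<= [set: K] ->
    (forall i, I i -> h i < w) -> exists2 j, j < w & forall i, I i -> h i < j.
  move=> IK hw; apply: contrapT => nj; apply: wK.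
  apply: (@card_le_trans _ _ _ (\bigcup_(i in I) ([set h i] `|` below (h i)))).
    apply: subset_card_le => j jw; apply: contrapT => nIj; apply: nj.
    exists j => // i Ii; rewrite ltNge; apply/negP; rewrite le_eqVlt => jh.
    by apply: nIj; exists i => //; move: jh => /predU1P[->|jh]; [left|right].
  apply: card_bigcup_le => // i Ii; apply: card_setU_le => //; last exact/ltwK/hw.
  exact/finK/finite_set1.
(* The bases cover [L] because [g] is cofinal; for [z < th] each is bounded, by minimality of
   [th]. *)
pose base z := [set x | exists2 y, y <= z & x <= g y].
pose OpF Phi x y := Op x y `|` [set phi x | phi in Phi].
pose NF Phi z := smallest (op_closed (OpF Phi)) (base z).
have NFmono Phi z z' : z <= z' -> NF Phi z `<=` NF Phi z'.
  move=> zz'; apply: smallest_op_closed_mono => [x y t //|x [y yz xy]].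
  by exists y => //; exact: le_trans zz'.
have NFsub Phi Phi' z : Phi `<=` Phi' -> NF Phi z `<=` NF Phi' z.
  move=> PP'; apply: smallest_op_closed_mono => [x y t [Opt|[phi /PP' ? <-]]|//].
    by left.
  by right; exists phi.
have /choice[step stepP] : forall Phi, exists f : L -> L, forall x z,
    [set: K] #<= A x `&` union_lt (NF Phi) z ->
    exists2 y, union_lt (NF Phi) z y & f y = x.
  move=> Phi; apply: exists_chain_selector => z z' zz' x [y yz Nyx].
  by exists y => //; exact: lt_le_trans zz'.
have [F FE] := wf_image_rec (fun _ Phi => step Phi) wfL.
pose Phi i := F @` below i.
have Phimono i j : i <= j -> Phi i `<=` Phi j.
  by move=> ij _ [k ki <-]; exists k => //; exact: lt_le_trans ij.
pose N := NF (Phi w).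
(* The union over [i < w] is already closed: two points and one selector all occur at a common stage
   below [w]. *)
have NE z x : N z x -> exists2 i, i < w & NF (Phi i) z x.
  move: x; apply: smallest_sub => [x y [i iw Nx] [j jw Ny] t OpFt|x bx]; last first.
    (* Bounding the empty family shows that [below w] is inhabited. *)
    have [|//|i iw _] := @wbound _ set0 id; first exact: card_ge0.
    by exists i => //; exact: sub_gen_smallest.
  have [u uw tu] : exists2 u, u < w & OpF (Phi u) x y t.
    case: OpFt => [Opt|[_ [k kw <-] <-]]; first by exists i => //; left.
    have [||u uw uP] := @wbound _ [set k] id; first exact/finK/finite_set1.
      by move=> _ ->.
    by exists u => //; right; exists (F k) => //; exists k => //; exact: uP.
  pose v := Order.max u (Order.max i j).
  exists v; first by rewrite /v !gt_max uw iw.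
  apply: (@op_closed_smallest _ (OpF (Phi v)) _ x y).
  - by apply: NFsub Nx; apply: Phimono; rewrite !le_max lexx orbT.
  - by apply: NFsub Ny; apply: Phimono; rewrite !le_max lexx !orbT.
  case: tu => [|[phi ? <-]]; [by left|right; exists phi => //].
  by apply: Phimono; last eassumption; rewrite le_max lexx.
exists N; split=> [z /cfE zth|||z _|z x /cfE zth KA].
- have [x xP] : exists x, forall y, y < z -> g y < x.
    apply: contrapT => nx; have /thmin : has_cofinal_map z.
      exists g => x; apply: contrapT => ny; apply: nx; exists x => y yz.
      by rewrite ltNge; apply/negP => xy; apply: ny; exists y.
    by rewrite leNgt zth.
  have [v0] := card_eq_below wfL K_lt_L; rewrite card_eq_le => /andP[Kv0 _].
  have [m mP] : exists m, forall t, base z t -> t <= m.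
    exists (Order.max x (g z)) => t [y yz ty]; apply: le_trans ty _.
    rewrite le_max; move: yz.
    by rewrite le_eqVlt => /predU1P[->|/xP/ltW->]; rewrite ?lexx ?orbT.
  (* [below v] bounds everything at once: [v0] accounts for |K|, [w] for the number of selectors,
     [m] for the base. *)
  pose v := Order.max v0 (Order.max w m).
  have below_le u : u <= v -> below u #<= below v.
    by move=> uv; apply: subset_card_le => t /lt_le_trans; apply.
  have Kv : [set: K] #<= below v.
    by apply: card_le_trans Kv0 (below_le _ _); rewrite le_max lexx.
  have vinf : infinite_set (below v) by move=> /(card_le_finite Kv).
  have vv := card_square_below wfL vinf.
  apply: card_le_lt_trans (L_card.2 v); apply: card_smallest_op_closed => //.
    apply: (@card_le_trans _ _ _ ([set m] `|` below m)).
      apply: subset_card_le => t /mP; rewrite le_eqVlt.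
      by move=> /predU1P[->|tm]; [left|right].
    apply: card_setU_le => //; last by apply: below_le; rewrite !le_max lexx !orbT.
    exact: card_le_trans (finK _ _ (finite_set1 _)) Kv.
  move=> y y'; apply: card_setU_le => //; first exact: card_le_trans (Op_le _ _) Kv.
  apply: card_le_trans (card_image_le _ _) _.
  apply: card_le_trans (card_image_le _ _) _.
  by apply: below_le; rewrite !le_max lexx !orbT.
- exact: NFmono.
- move=> x; have [y yth xy] := gP x; exists y; first exact/cfE.
  by apply: sub_gen_smallest; exists y.
- by move=> x y Nx Ny t Opt; apply: (op_closed_smallest Nx Ny); left.
have [B BAN BK] := subset_of_card KA.
have /choice[h hP] : forall b, exists i, B b -> i < w /\ union_lt (NF (Phi i)) z b.
  move=> b; have [Bb|] := pselect (B b); last by exists w.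
  have [_ [y yz /NE[i iw Nb]]] := BAN b Bb.
  by exists i => _; split=> //; exists y.
have [||j jw jP] := wbound _ B h; first exact: ((card_eqPle _ _).1 BK).1.
  by move=> b /hP[].
(* [F j] selects for the chain of stage [j], and [N] is closed under it because [j < w]. *)
have [|y [u uz Nuy] Fyx] := stepP (Phi j) x z.
  apply: card_le_trans ((card_eqPle _ _).1 BK).2 _.
  apply: subset_card_le => b Bb; split; first by case: (BAN b Bb).
  have [_ [u uz Nub]] := hP b Bb; exists u => //.
  by apply: NFsub Nub; apply: Phimono; exact/ltW/jP.
have Nuy' : N u y by apply: NFsub Nuy; apply: Phimono; exact: ltW.
exists u => //; rewrite -Fyx -FE.
by apply: (op_closed_smallest Nuy' Nuy'); right; exists (F j) => //; exists j.
Qed.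

Lemma exists_good_chain : exists N, good_chain N.
Proof.
have [/singular_good_chain//|reg] := pselect (exists w : L, has_cofinal_map w).
by apply: regular_good_chain => w wcof; apply: reg; exists w.
Qed.
End Chains.
End HereditarilyEssentiallyDisjoint.

(** * From a chain to the partition *)

Theorem theorem4p3 (K : Type) (d : Order.disp_t) (L : orderType d)
    (A : L -> set L)
    (L_card : is_cardinal L)
    (K_infinite : [set: nat] #<= [set: K])
    (K_lt_L : [set: K] #< [set: L])
    (A_inj : injective A)
    (A_ge : forall a : L, subsets_ge K [set: L] (A a))
    (A_hed : hereditarily_essentially_disjoint K (range A)) :
  exists X : L -> set L,
    [/\ forall z, cf L z -> subsets_lt L [set: L] (X z),
        trivIset (cf L) X,
        \bigcup_(z in cf L) X z = [set: L] &
        [/\ (forall z, cf L z ->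
               forall a a', union_le X z a -> union_le X z a' -> a <> a' ->
               A a `&` A a' `<=` union_le X z),
            (forall z, cf L z -> forall a, X z a ->
               A a `&` union_lt X z #< [set: K]) &
            (forall z, cf L z -> forall a, X z a ->
               [set: K] #<= A a `&` X z)]].
Proof.
have wfL := L_card.1.
have Kinf : infinite_set [set: K] by exact/infiniteP.
have [H HK] := choice (subsets_eq_inhab A_ge).
(* [H x] serves (M3) and the intersections serve (M1). Excluding [x = y] keeps the values of size at
   most |K|, since [A x] may be larger. *)
pose Op x y := H x `|` [set t | x <> y /\ (A x `&` A y) t].
have Op_le x y : Op x y #<= [set: K].
  apply: card_setU_le => //; first exact: (card_square wfL).
    exact: ((card_eqPle _ _).1 (HK x).2).1.
  have [->|xy] := pselect (x = y).
    by rewrite (_ : mkset _ = set0) ?card_ge0//; apply/seteqP; split=> // t [].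
  apply: (@card_le_trans _ _ _ (A x `&` A y)).
    by apply: subset_card_le => t [].
  apply: (card_ltNge wfL _).1.
  exact: (almost_disjoint L_card K_infinite K_lt_L A_inj).
have [N [Nlt Nmono Ncov NOp Ngood]] :=
  exists_good_chain L_card K_infinite K_lt_L A_inj A_ge A_hed Op_le.
pose X z := N z `\` union_lt N z.
have XN z t : N z t -> exists2 y, y <= z & X y t.
  move=> Nzt; have [|y Ny ymin] := @least_elt _ _ wfL [set y | N y t]; first by exists z.
  exists y; first exact: ymin.
  by split=> // -[u uy /ymin]; rewrite leNgt uy.
have XleE z : union_le X z = N z.
  apply/seteqP; split=> [t [y yz [Ny _]]|t /XN[y yz Xy]]; first exact: Nmono Ny.
  by exists y.
have XltE z : union_lt X z = union_lt N z.
  apply/seteqP; split=> [t [y yz [Ny _]]|t [y yz /XN[u uy Xu]]]; first by exists y.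
  by exists u => //; exact: le_lt_trans yz.
have M2 z a : cf L z -> X z a -> A a `&` union_lt N z #< [set: K].
  move=> cfz [_ nNa]; apply: (card_ltNge wfL) => KA.
  exact: nNa (Ngood _ _ cfz KA).
exists X; split; last split.
- move=> z cfz; split=> //; apply: card_le_lt_trans (Nlt z cfz).
  by apply: subset_card_le => t [].
- have Xlt z z' t : z < z' -> X z t -> ~ X z' t.
    by move=> zz' [Nz _] [_]; apply; exists z.
  move=> z z' _ _ [t [Xz Xz']]; have [/Xlt/(_ Xz)//|/Xlt/(_ Xz')//|//] := ltgtP z z'.
- apply/seteqP; split=> // t _; have [z cfz /XN[y yz Xy]] := Ncov t.
  by exists y => // w wy; apply: cfz; exact: le_trans yz.
- move=> z cfz a a'; rewrite !XleE => Na Na' aa' t At.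
  by apply: (NOp z cfz a a') => //; right.
- by move=> z cfz a Xa; rewrite XltE; exact: M2.
(* Otherwise (M2) would make [A a] meet [N z] in fewer than |K| points, although [H a] lies in
   both. *)
- move=> z cfz a Xza; apply: contrapT => /(card_ltNge wfL) AX.
  have /(card_lt_setU wfL Kinf K_lt_L AX) := M2 z a cfz Xza.
  case=> _; apply; apply: card_le_trans ((card_eqPle _ _).1 (HK a).2).2 _.
  apply: subset_card_le => t Ht; have At := (HK a).1 t Ht.
  have Nt : N z t by apply: (NOp z cfz a a) => //; [case: Xza|case: Xza|left].
  by have [?|?] := pselect (union_lt N z t); [right|left].
Qed.
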